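(* Let $W$ be a left $GL^+(2,\mathbb{Q})$-module and $\mu$ an $SL(2,\mathbb{Z})$-modular $W$-valued pseudo-measure. Then the following identity of formal Dirichlet series with coefficients in $W$ holds: $$Z_+(s)\cdot Z_-(s)\cdot LM_\mu(s)=\sum_{n=1}^\infty\frac{(T_n\mu)(\infty,0)}{n^s}.$$
   Context: $\mathbf{P}^1(\mathbb{Q})=\mathbb{Q}\cup\{\infty\}$ with fractional linear action. A $W$-valued pseudo-measure is $\mu:\mathbf{P}^1(\mathbb{Q})^2\to W$ with $\mu(\alpha,\alpha)=0$, $\mu(\alpha,\beta)+\mu(\beta,\alpha)=0$, $\mu(\alpha,\beta)+\mu(\beta,\gamma)+\mu(\gamma,\alpha)=0$; it is $SL(2,\mathbb{Z})$-modular if $\mu(g\alpha,g\beta)=g[\mu(\alpha,\beta)]$ for $g\in SL(2,\mathbb{Z})$. Formal Dirichlet series: for an abelian group $A$, a formal series $\sum_{n\ge1}a_nn^{-s}$ is just the sequence $(a_n)$; given a biadditive pairing $A\times B\to C$, the product of $\sum a_nn^{-s}$ and $\sum b_nn^{-s}$ is $\sum c_nn^{-s}$ with $c_n=\sum_{d_1d_2=n}a_{d_1}\cdot b_{d_2}$. Here coefficients lie in $\mathbb{Z}[GL^+(2,\mathbb{Q})]$ (acting on $W$ and on itself by multiplication) or in $W$; the left side is $Z_+\cdot(Z_-\cdot LM_\mu)$. Define $Z_-(s)=\sum_{d_1\ge1}\begin{pmatrix}1&0\\0&d_1^{-1}\end{pmatrix}d_1^{-s}$ and $Z_+(s)=\sum_{d_2\ge1}\begin{pmatrix}d_2^{-1}&0\\0&1\end{pmatrix}d_2^{-s}$.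 The Lévy–Mellin transform $LM_\mu(s)$ is defined as $\int_0^{1/2}L(f_\mu)(\alpha,s)\,d\alpha$, where $L(f_\mu)=\sum_{(c,d)}f_\mu(I^-_{c,d})\chi_{I^-_{c,d}}$ is the Lévy function with $f_\mu(I^-_{c,d})(s)=|I^-_{c,d}|^{-1}d^{-s}\begin{pmatrix}1&-c/d\\0&1/d\end{pmatrix}[\mu(\infty,c/d)]$; here $(c,d)$ runs over $\overline L=\{(c,d)\in\mathbb{Z}^2:1\le c\le d,\gcd(c,d)=1\}$, $I^-_{1,1}=[0,1/2]$, and for $c<d$, $I^-_{c,d}=[g(0),g(1)]\subset[0,1/2]$ where $g$ is the unique matrix in $GL(2,\mathbb{Z})$ of determinant $-1$ with nonnegative entries non-decreasing to the right in rows and downward in columns and with lower row $(c,d)$; $|I|$ is the length. Integrating term by term, $LM_\mu(s)=\sum_{(c,d)\in\overline L}d^{-s}\begin{pmatrix}1&-c/d\\0&1/d\end{pmatrix}[\mu(\infty,c/d)]$. The Hecke operator $T_n$ is $(T_n\mu)(\alpha,\beta)=\sum_\delta\delta^{-1}[\mu(\delta\alpha,\delta\beta)]$, the sum over the matrices $\delta=\begin{pmatrix}a&b\\0&d\end{pmatrix}$ with $a,d\ge1$, $ad=n$, $1\le b\le d$. *)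

(* Defs.v *)
From HB Require Import structures.
From mathcomp Require Import all_boot all_order all_algebra.
From mathcomp.multinomials Require Import freeg.
From mathcomp Require Import zify ring.

Set Implicit Arguments.
Unset Strict Implicit.
Unset Printing Implicit Defensive.

Import Order.TTheory GRing.Theory Num.Theory.
Local Open Scope ring_scope.

Definition mx22 (R : Type) (a b c d : R) : 'M[R]_2 :=
  \matrix_(i < 2, j < 2)
    if i == 0 :> nat then (if j == 0 :> nat then a else b)
    else (if j == 0 :> nat then c else d).

Lemma det_mx22 (R : comPzRingType) (a b c d : R) :
  \det (mx22 a b c d) = a * d - b * c.
Proof.
rewrite (expand_det_row _ ord0) big_ord_recl big_ord1 /cofactor !det_mx11.
by rewrite !mxE /= expr0 mul1r expr1 mulN1r mulrN.
Qed.

Record GL2pQ := MkGL2pQ { glval :> 'M[rat]_2; glvalP : 0 < \det glval }.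

HB.instance Definition _ := [isSub for glval].
HB.instance Definition _ := [Choice of GL2pQ by <:].

Lemma gl_one_subproof : 0 < \det (1%:M : 'M[rat]_2).
Proof. by rewrite det1 ltr01. Qed.

Lemma gl_mul_subproof (g h : GL2pQ) : 0 < \det (glval g *m glval h).
Proof. by rewrite det_mulmx mulr_gt0 ?glvalP. Qed.

Lemma gl_inv_subproof (g : GL2pQ) : 0 < \det (invmx (glval g)).
Proof. by rewrite det_inv invr_gt0 glvalP. Qed.

Definition gl_one := MkGL2pQ gl_one_subproof.
Definition gl_mul g h := MkGL2pQ (gl_mul_subproof g h).
Definition gl_inv g := MkGL2pQ (gl_inv_subproof g).

Lemma gl_unitmx (g : GL2pQ) : glval g \in unitmx.
Proof. by rewrite unitmxE unitfE gt_eqF ?glvalP. Qed.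

Lemma gl_mulA : associative gl_mul.
Proof. by move=> x y z; apply: val_inj; rewrite /= mulmxA. Qed.

Lemma gl_mul1 : left_id gl_one gl_mul.
Proof. by move=> x; apply: val_inj; rewrite /= mul1mx. Qed.

Lemma gl_mulr1 : right_id gl_one gl_mul.
Proof. by move=> x; apply: val_inj; rewrite /= mulmx1. Qed.

Lemma gl_mulV : left_inverse gl_one gl_inv gl_mul.
Proof. by move=> x; apply: val_inj; rewrite /= mulVmx ?gl_unitmx. Qed.

Lemma gl_mulrV : right_inverse gl_one gl_inv gl_mul.
Proof. by move=> x; apply: val_inj; rewrite /= mulmxV ?gl_unitmx. Qed.

HB.instance Definition _ :=
  isGroup.Build GL2pQ gl_mulA gl_mul1 gl_mulr1 gl_mulV gl_mulrV.

(* The junk value 1 is taken only when [ad - bc <= 0]. *)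
Definition gl (a b c d : rat) : GL2pQ := insubd (1%g : GL2pQ) (mx22 a b c d).

Definition is_left_module (W : zmodType) (act : GL2pQ -> W -> W) : Prop :=
  [/\ forall w, act 1%g w = w,
      forall g h w, act (g * h)%g w = act g (act h w)
    & forall g w w', act g (w + w') = act g w + act g w'].

Record SL2Z := MkSL2Z { slval :> 'M[int]_2; slvalP : \det slval = 1 }.

Lemma sl_gl_subproof (g : SL2Z) : 0 < \det (map_mx intr (slval g) : 'M[rat]_2).
Proof. by rewrite det_map_mx slvalP ltr01. Qed.

Definition sl_gl (g : SL2Z) : GL2pQ := MkGL2pQ (sl_gl_subproof g).

(* [None] is the point at infinity. *)
Definition P1Q := option rat.

Definition moebius (g : 'M[rat]_2) (x : P1Q) : P1Q :=
  let a := g ord0 ord0 in let b := g ord0 ord_max in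
  let c := g ord_max ord0 in let d := g ord_max ord_max in
  match x with
  | None => if c == 0 then None else Some (a / c)
  | Some r => if c * r + d == 0 then None else Some ((a * r + b) / (c * r + d))
  end.

Definition pseudo_measure (W : zmodType) (mu : P1Q -> P1Q -> W) : Prop :=
  [/\ forall x, mu x x = 0,
      forall x y, mu x y + mu y x = 0
    & forall x y z, mu x y + mu y z + mu z x = 0].

Definition SL2Z_modular (W : zmodType) (act : GL2pQ -> W -> W)
    (mu : P1Q -> P1Q -> W) : Prop :=
  forall (g : SL2Z) (x y : P1Q),
    mu (moebius (sl_gl g) x) (moebius (sl_gl g) y) = act (sl_gl g) (mu x y).

Definition hecke (W : zmodType) (act : GL2pQ -> W -> W) (n : nat)
    (mu : P1Q -> P1Q -> W) (x y : P1Q) : W :=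
  \sum_(a <- divisors n) let d := (n %/ a)%N in
    \sum_(1 <= b < d.+1) let delta := gl a%:R b%:R 0 d%:R in
      act (delta^-1)%g (mu (moebius delta x) (moebius delta y)).

(* [a n] is the coefficient of [n^-s] for [n >= 1]; [a 0] is irrelevant. *)
Definition dirichlet (A : Type) := nat -> A.

Definition dirichlet_eq (A : Type) (a b : dirichlet A) : Prop :=
  forall n, (0 < n)%N -> a n = b n.

Definition dirichlet_mul (A B : Type) (C : zmodType) (op : A -> B -> C)
    (a : dirichlet A) (b : dirichlet B) : dirichlet C :=
  fun n => \sum_(d <- divisors n) op (a d) (b (n %/ d)%N).

(* The additive group of the group ring Z[GL^+(2,Q)]. *)
Notation ZGL2pQ := {freeg GL2pQ / int}.

(* The Z-linear extension of the action, [zmodule W] being [W] as an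
   [lmodType int]. *)
Definition ract (W : zmodType) (act : GL2pQ -> W -> W) (x : ZGL2pQ) (w : W)
  : W := fglift (fun g => act g w : zmodule W) x.

Definition Zminus : dirichlet ZGL2pQ := fun d => << gl 1 0 0 d%:R^-1 >>.
Definition Zplus : dirichlet ZGL2pQ := fun d => << gl d%:R^-1 0 0 1 >>.

Definition is_levy_mx (c d : nat) (g : 'M[int]_2) : bool :=
  [&& \det g == -1,
      [forall i, forall j, 0 <= g i j],
      [forall i, g i ord0 <= g i ord_max],
      [forall j, g ord0 j <= g ord_max j],
      g ord_max ord0 == c%:Z & g ord_max ord_max == d%:Z].

(* Monotonicity bounds the upper row by [d], so a search below [d] finds the
   matrix; see [levy_mxP] and [levy_mx_uniq]. *)
Definition levy_mx (c d : nat) : 'M[int]_2 :=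
  let M (u : 'I_d.+1 * 'I_d.+1) := mx22 (u.1 : nat)%:Z (u.2 : nat)%:Z c%:Z d%:Z in
  odflt 0 (omap M [pick u | is_levy_mx c d (M u)]).

Lemma is_levy_mxE (c d a b : nat) :
  is_levy_mx c d (mx22 a%:Z b%:Z c%:Z d%:Z) =
  [&& (b * c == a * d + 1)%N, (a <= b)%N, (c <= d)%N, (a <= c)%N & (b <= d)%N].
Proof.
have E i j : mx22 a%:Z b%:Z c%:Z d%:Z i j =
    (nth 0%N (nth [::] [:: [:: a; b]; [:: c; d]] i) j)%:Z.
  by rewrite mxE; case: i j => [[|[|i]] ?] [[|[|j]] ?].
rewrite /is_levy_mx det_mx22 !E /= !eqxx !andbT.
have -> : (a%:Z * d%:Z - b%:Z * c%:Z == -1) = (b * c == a * d + 1)%N.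
  by apply/eqP/eqP; lia.
congr andb; apply/and3P/and4P.
  case=> _ /forallP R /forallP C; split.
  - by have := R ord0; rewrite !E /=; lia.
  - by have := R ord_max; rewrite !E /=; lia.
  - by have := C ord0; rewrite !E /=; lia.
  - by have := C ord_max; rewrite !E /=; lia.
case=> ab cd ac bd; split=> //.
- by apply/forallP => i; apply/forallP => j; rewrite E.
- by apply/forallP => -[[|[|i]] Hi] //; rewrite !E.
- by apply/forallP => -[[|[|i]] Hi] //; rewrite !E.
Qed.

Lemma levy_mxP (c d : nat) :
  (0 < c < d)%N -> coprime c d -> is_levy_mx c d (levy_mx c d).
Proof.
move=> /andP[c0 cd] cop; rewrite /levy_mx; case: pickP => [u //|no] /=.
case: (egcdnP d c0) => b a; rewrite (eqP cop) muln1 => e ac.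
have bd : (b < d.+1)%N by nia.
have ad : (a < d.+1)%N by lia.
have := no (Ordinal ad, Ordinal bd); rewrite is_levy_mxE /= => /negP[].
by apply/and5P; split; nia.
Qed.

Lemma levy_mx_uniq (c d : nat) (g : 'M[int]_2) :
  (0 < c < d)%N -> coprime c d -> is_levy_mx c d g -> g = levy_mx c d.
Proof.
move=> cd cop; have eta h : is_levy_mx c d h ->
    exists a b : nat, h = mx22 a%:Z b%:Z c%:Z d%:Z.
  case/and5P=> _ /forallP h0 _ _ /andP[/eqP hc /eqP hd].
  exists `|h ord0 ord0|%N, `|h ord0 ord_max|%N; apply/matrixP=> i j.
  rewrite mxE -hc -hd !gez0_abs ?(forallP (h0 _)) //.
  by case: i j => [[|[|i]] Hi] [[|[|j]] Hj] //=; congr (h _ _); apply: val_inj.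
have main a b a' b' : (b <= b')%N ->
    is_levy_mx c d (mx22 a%:Z b%:Z c%:Z d%:Z) ->
    is_levy_mx c d (mx22 a'%:Z b'%:Z c%:Z d%:Z) -> (a = a') /\ (b = b').
  rewrite !is_levy_mxE => bb /and5P[/eqP e _ _ ac bd] /and5P[/eqP e' _ _ ac' bd'].
  have b'd : (b' < d)%N.
    rewrite ltn_neqAle bd' andbT; apply/eqP => E; move: e' cd; rewrite E => e' cd.
    have : (d %| a' * d + 1)%N by rewrite -e' dvdn_mulr.
    by rewrite dvdn_addr ?dvdn_mull // dvdn1; lia.
  have dv : (d %| b' - b)%N.
    rewrite -(@Gauss_dvdl _ _ c) 1?coprime_sym // mulnBl e e' subnDr -mulnBl.
    exact: dvdn_mull.
  have b0 : (b' - b = 0)%N by apply/eqP; move: dv; apply: contraLR => ?; rewrite gtnNdvd; lia.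
  have Eb : b = b' by lia.
  split=> //; move: e'; rewrite -Eb e => /addIn/eqP.
  by rewrite eqn_pmul2r => [/eqP //|]; lia.
move=> Pg; have Pl := levy_mxP cd cop.
have [a [b Eg]] := eta _ Pg; have [a' [b' El]] := eta _ Pl.
rewrite Eg in Pg *; rewrite El in Pl *.
by have [/main H|/ltnW/main H] := leqP b b';
  [have [-> ->] := H _ _ Pg Pl | have [-> ->] := H _ _ Pl Pg].
Qed.

(* The interval I^-_{c,d}, as an unordered pair of endpoints. *)
Definition levy_itv (c d : nat) : rat * rat :=
  if (c == 1%N) && (d == 1%N) then (0, 2^-1) else
  let g : 'M[rat]_2 := map_mx intr (levy_mx c d) in
  (odflt 0 (moebius g (Some 0)), odflt 0 (moebius g (Some 1))).

Definition itv_length (I : rat * rat) : rat := `|I.2 - I.1|.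

(* A formal step function, the sum over the list of the terms
   [coef * chi_itv (alpha)] times [vec].  The rational coefficient is kept apart
   from the vector since [W] is only a Z-module. *)
Record step_term (W : Type) :=
  StepTerm { step_coef : rat; step_itv : rat * rat; step_vec : W }.

(* [q w], meaningful for integral [q]. *)
Definition scale_rat (W : zmodType) (q : rat) (w : W) : W :=
  if q \is a Num.int then w *~ numq q else 0.

(* The integral of a step function, the integral of [chi_I] being [|I|].  No
   intersection with [0,1/2] is taken: with determinant -1, some intervals lie in
   [1/2,1] (for (2,3), the interval is [3/5,2/3]). *)
Definition step_integral (W : zmodType) (f : seq (step_term W)) : W :=
  \sum_(t <- f)
    scale_rat (step_coef t * itv_length (step_itv t)) (step_vec t).

(* The coefficients of [L(f_mu)(alpha, s)], as formal step functions in alpha. *)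
Definition levy_fun (W : zmodType) (act : GL2pQ -> W -> W)
    (mu : P1Q -> P1Q -> W) : dirichlet (seq (step_term W)) :=
  fun d => [seq StepTerm (itv_length (levy_itv c d))^-1 (levy_itv c d)
              (act (gl 1 (- (c%:R / d%:R)) 0 d%:R^-1)
                   (mu None (Some (c%:R / d%:R))))
           | c <- iota 1 d & coprime c d].

Definition levy_mellin (W : zmodType) (act : GL2pQ -> W -> W)
    (mu : P1Q -> P1Q -> W) : dirichlet W :=
  fun d => step_integral (levy_fun act mu d).

Lemma itv_length_neq0 (c d : nat) :
  (0 < c <= d)%N -> coprime c d -> itv_length (levy_itv c d) != 0.
Proof.
move=> cd cop; rewrite /itv_length /levy_itv.
case: ifP => [_|nn]; first by [].
have lt : (0 < c < d)%N.
  case/andP: cd => c0; rewrite c0 leq_eqVlt => /orP[/eqP E|//].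
  by move: cop; rewrite -E /coprime gcdnn => E1; move: nn; rewrite -E E1.
have := levy_mxP lt cop; set g := levy_mx c d => /and5P[/eqP D h0 _ _ /andP[/eqP gc /eqP gd]].
rewrite /= !mxE gc gd mulr0 add0r mulr1.
have d0 : (d%:~R : rat) != 0 by rewrite intr_eq0; lia.
have e0 : (c%:~R + d%:~R : rat) != 0 by rewrite -intrD intr_eq0; lia.
rewrite (negbTE d0) (negbTE e0) /=.
rewrite normr_eq0 subr_eq0 /=. rewrite mulr0 add0r mulr1.
apply/eqP => E.
have : (\det g)%:~R = 0 :> rat.
  rewrite (expand_det_row _ ord0) big_ord_recl big_ord1 /cofactor !det_mx11 !mxE /=.
  rewrite expr0 mul1r expr1 mulN1r mulrN.
  have -> : fintype.lift ord0 ord0 = ord_max :> 'I_2 by apply: val_inj.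
  have -> : fintype.lift ord_max ord0 = ord0 :> 'I_2 by apply: val_inj.
  rewrite gc gd; move/eqP: E; rewrite eqr_div ?d0 ?e0 // => /eqP E.
  rewrite rmorphB !rmorphM /=.
  move: E; set A := (g ord0 ord0)%:~R; set B := (g ord0 ord_max)%:~R; set C := c%:~R; set F := d%:~R.
  move=> E; have -> : A * F - B * C = (A+B)*F - B*(C+F) by ring.
  by rewrite E subrr.
by rewrite D.
Qed.

Lemma scale_rat1 (W : zmodType) (w : W) : scale_rat 1 w = w.
Proof. by rewrite /scale_rat rpred1 -{2}[w]mulr1z. Qed.

Lemma levy_mellinE (W : zmodType) (act : GL2pQ -> W -> W)
    (mu : P1Q -> P1Q -> W) (d : nat) :
  levy_mellin act mu d =
    \sum_(c <- iota 1 d | coprime c d)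
      act (gl 1 (- (c%:R / d%:R)) 0 d%:R^-1) (mu None (Some (c%:R / d%:R))).
Proof.
rewrite /levy_mellin /step_integral /levy_fun big_map big_filter.
rewrite big_seq_cond [RHS]big_seq_cond; apply: eq_bigr => c /andP[].
rewrite mem_iota => cd cop /=.
have nz : itv_length (levy_itv c d) != 0 by apply: itv_length_neq0 cop; lia.
by rewrite mulVf // scale_rat1.
Qed.

(* Main.v *)
Require Import Defs.
From mathcomp Require Import all_boot all_order all_algebra.
From mathcomp.multinomials Require Import freeg.
From mathcomp Require Import ring.

Set Implicit Arguments.
Unset Strict Implicit.
Unset Printing Implicit Defensive.

Import Order.TTheory GRing.Theory Num.Theory.
Local Open Scope ring_scope.

(** The two coefficients of n^-s agree term by term. On the left, a term is given by a dividing n, e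
    dividing n/a and c coprime to k = n/(ae) with 1 <= c <= k. On the right, it is a matrix delta =
    (a, b; 0, d) with ad = n and 1 <= b <= d. Setting e = gcd(b, d), b = ce, d = ke matches the two
    index sets ([sum_gcd_partition]). Under this match, delta^-1 is the product of the three
    matrices on the left ([hecke_matrix_inv]), while delta fixes infinity and sends 0 to b/d =
    c/k. *)

(* Writing b / D in lowest terms as c / (D / e), with e = gcd(b, D), turns the
   Hecke sum over b into the Levy sum over coprime pairs. *)
Lemma sum_gcd_partition (W : zmodType) (F : nat -> W) (D : nat) :
  (0 < D)%N ->
  \sum_(1 <= b < D.+1) F b =
    \sum_(e <- divisors D)
      \sum_(c <- iota 1 (D %/ e) | coprime c (D %/ e)) F (c * e)%N.
Proof.
move=> D0.
(* Each b has exactly one gcd with D, so the inner sum has a single term. *)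
have -> : \sum_(1 <= b < D.+1) F b =
    \sum_(1 <= b < D.+1) \sum_(e <- divisors D | gcdn b D == e) F b.
  apply: eq_bigr => b _.
  rewrite big_mkcond (bigD1_seq (gcdn b D)) ?divisors_uniq //=; last first.
    by rewrite -dvdn_divisors ?dvdn_gcdr.
  by rewrite eqxx big1 ?addr0 // => e; rewrite eq_sym => /negbTE ->.
rewrite (exchange_big_dep xpredT) //= [LHS]big_seq [RHS]big_seq.
apply: eq_bigr => e; rewrite -dvdn_divisors // => /dvdnP[k Dk].
have [k0 e0] : (0 < k)%N /\ (0 < e)%N by apply/andP; rewrite -muln_gt0 -Dk.
rewrite Dk mulnK // /index_iota subSS subn0 -big_filter -[RHS]big_filter.
(* The b with gcd(b, ke) = e are exactly the multiples ce with c coprime to k. *)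
rewrite -[RHS](big_map (fun c => c * e)%N xpredT F); apply: perm_big.
apply: uniq_perm => [||b]; first by rewrite filter_uniq ?iota_uniq.
  rewrite map_inj_uniq ?filter_uniq ?iota_uniq // => x y /eqP.
  by rewrite eqn_pmul2r // => /eqP.
rewrite mem_filter mem_iota add1n ltnS; apply/idP/mapP => [|[c]].
  case/andP=> /eqP g /andP[b0 bD].
  have /dvdnP[c bc] : (e %| b)%N by rewrite -g dvdn_gcdl.
  exists c => //; move: g b0 bD; rewrite bc -muln_gcdl => /eqP.
  rewrite -{2}[e]mul1n eqn_pmul2r // => g; rewrite muln_gt0 leq_pmul2r //.
  by case/andP=> c0 _ ck; rewrite mem_filter mem_iota add1n ltnS /coprime g c0.
rewrite mem_filter mem_iota add1n ltnS => /andP[/eqP g /andP[c0 ck]] ->.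
by rewrite -muln_gcdl g mul1n eqxx muln_gt0 c0 e0 leq_pmul2r.
Qed.

Lemma glvalE (a b c d : rat) : 0 < a * d - b * c ->
  glval (gl a b c d) = mx22 a b c d.
Proof. by move=> h; rewrite /gl [LHS]val_insubd det_mx22 h. Qed.

Lemma mul_mx22 (R : comPzRingType) (a b c d a' b' c' d' : R) :
  mx22 a b c d *m mx22 a' b' c' d' =
  mx22 (a * a' + b * c') (a * b' + b * d') (c * a' + d * c') (c * b' + d * d').
Proof.
apply/matrixP => i j; rewrite !mxE big_ord_recl big_ord1 !mxE /=.
by case: ifP => _; case: ifP.
Qed.

Lemma moebius_gl_inf (a b d : rat) : 0 < a * d ->
  moebius (gl a b 0 d) None = None.
Proof. by move=> h; rewrite /moebius glvalE ?mulr0 ?subr0 // !mxE. Qed.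

Lemma moebius_gl_0 (a b d : rat) : 0 < a * d ->
  moebius (gl a b 0 d) (Some 0) = Some (b / d).
Proof.
move=> h; rewrite /moebius glvalE ?mulr0 ?subr0 // !mxE /= !add0r.
by case: eqP h => // ->; rewrite mulr0 ltxx.
Qed.

(** This inverts the factorization (a, ce; 0, ke) = (1, c; 0, k) diag(1, e) diag(a, 1). *)
Lemma hecke_matrix_inv (a e c k : nat) :
  (0 < a)%N -> (0 < e)%N -> (0 < k)%N ->
  (gl a%:R (c * e)%:R 0 (k * e)%:R)^-1%g =
  (gl a%:R^-1 0 0 1 * (gl 1 0 0 e%:R^-1 *
    gl 1 (- (c%:R / k%:R)) 0 k%:R^-1))%g.
Proof.
rewrite -!(ltr0n rat) !natrM => a0 e0 k0.
have [a1 [e1 k1]] : a%:R != 0 :> rat /\ e%:R != 0 :> rat /\ k%:R != 0 :> rat.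
  by rewrite !gt_eqF.
have pos : forall x b y : rat, 0 < x -> 0 < y -> 0 < x * y - b * 0.
  by move=> *; rewrite mulr0 subr0 mulr_gt0.
(* It suffices that the product with the claimed inverse is 1, a matrix identity over the
   rationals. *)
apply: mulg1_eq; apply: val_inj.
rewrite /= !glvalE ?pos ?mulr_gt0 ?invr_gt0 // !mul_mx22.
apply/matrixP => i j; rewrite !mxE.
by case: i j => [[|[|i]] //= ?] [[|[|j]] //= ?];
  rewrite /eq_op /=; field; rewrite ?a1 ?e1 ?k1.
Qed.

Lemma ractU (W : zmodType) (act : GL2pQ -> W -> W) (g : GL2pQ) (w : W) :
  ract act << g >> w = act g w.
Proof. by rewrite /ract liftU scale1r. Qed.

Lemma left_module_sum (W : zmodType) (act : GL2pQ -> W -> W) (I : Type)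
    (r : seq I) (P : pred I) (F : I -> W) (g : GL2pQ) :
  is_left_module act ->
  act g (\sum_(i <- r | P i) F i) = \sum_(i <- r | P i) act g (F i).
Proof.
case=> _ _ actD; apply: (big_morph (act g) (actD g)).
(* Additivity forces [act g 0 = 0], by cancelling [act g 0]. *)
by apply: (addrI (act g 0)); rewrite -actD !addr0.
Qed.

Theorem theorem3p4 (W : zmodType) (act : GL2pQ -> W -> W)
    (mu : P1Q -> P1Q -> W) :
  is_left_module act ->
  pseudo_measure mu ->
  SL2Z_modular act mu ->
  dirichlet_eq
    (dirichlet_mul (ract act) Zplus
       (dirichlet_mul (ract act) Zminus (levy_mellin act mu)))
    (fun n : nat => hecke act n mu None (Some 0%R)).
Proof.
move=> actW _ _ n n0; rewrite /hecke /dirichlet_mul.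
rewrite [LHS]big_seq [RHS]big_seq; apply: eq_bigr => a.
rewrite -dvdn_divisors // => an.
have a0 : (0 < a)%N := dvdn_gt0 n0 an.
have D0 : (0 < n %/ a)%N by rewrite divn_gt0 // dvdn_leq.
rewrite ractU left_module_sum // sum_gcd_partition //.
rewrite [LHS]big_seq [RHS]big_seq; apply: eq_bigr => e.
rewrite -dvdn_divisors // => eD.
have e0 : (0 < e)%N := dvdn_gt0 D0 eD.
have k0 : (0 < n %/ a %/ e)%N by rewrite divn_gt0 // dvdn_leq.
rewrite ractU levy_mellinE !left_module_sum //; apply: eq_bigr => c _.
(* From here [n %/ a] is written [k * e], the lower right entry of delta. *)
move: (divnK eD) k0; set k := (_ %/ e)%N => <- k0.
have ad0 : 0 < a%:R * (k * e)%:R :> rat by rewrite -natrM ltr0n !muln_gt0 a0 k0.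
rewrite moebius_gl_inf // moebius_gl_0 // hecke_matrix_inv //.
have [_ actM _] := actW; rewrite !actM !natrM.
(* The arguments of [mu] agree, since ce/(ke) = c/k. *)
by rewrite -mulf_div divff ?mulr1 // pnatr_eq0 -lt0n.
Qed.
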